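(* Let $(M^m,g)$ and $(N^n,h)$ be Riemannian manifolds of dimensions $m>n$, and let $\varphi:(M^m,g)\to(N^n,h)$ be a submersive harmonic morphism with dilation $\lambda:M\to(0,\infty)$. Let $\mathcal V=\ker \mathrm d\varphi$, let $\mathcal H=\mathcal V^{\perp}$ be its $g$-orthogonal complement, and let $K>0$ be the coupling constant. Then: (i) $\varphi$ is $\sigma_{1,2}$-critical with respect to the metric $$g_{1/\lambda}=\lambda^{2}\,g^{\mathcal H}+\lambda^{-\frac{2n-4}{m-n}}\,g^{\mathcal V}$$ on $M$ (biconformally related to $g$). (ii) For a smooth function $b:M\to(0,\infty)$, $\varphi$ is $\sigma_{1,2}$-critical with respect to the conformally related metric $\widetilde g=b^{2}\cdot g$ on $M$ if and only if $$\mathrm{grad}^{\mathcal H}\left[b^{m-4}\left(b^{2}+K(n-1)\lambda^{2}\right)\right]=0 .$$ In particular, if $m\neq 4$, then $\varphi$ is $\sigma_{2}$-critical with respect to the conformally related metric $\widetilde g=\lambda^{\frac{4}{4-m}}\cdot g$.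
   Context: All manifolds and maps are smooth. For a map $\varphi:(M,g)\to(N,h)$ between Riemannian manifolds and a constant $K>0$, consider the energy $$\mathcal E_{\sigma_{1,2}}(\varphi)=\mathcal E_{\sigma_1}(\varphi)+K\,\mathcal E_{\sigma_2}(\varphi)=\frac12\int_M\left[|\mathrm d\varphi|^2+K\,|\wedge^2\mathrm d\varphi|^2\right]\nu_g .$$ Let $e(\varphi)=\frac12|\mathrm d\varphi|^2$, let $\mathfrak C_\varphi=\mathrm d\varphi^{t}\circ\mathrm d\varphi\in\mathrm{End}(TM)$ be the Cauchy-Green tensor, let $\tau(\varphi)=\mathrm{trace}\,\nabla\mathrm d\varphi$ be the tension field, and let $$\tau_{\sigma_2}(\varphi)=2\left[e(\varphi)\tau(\varphi)+\mathrm d\varphi(\mathrm{grad}\,e(\varphi))\right]-\mathrm{trace}\,(\nabla\mathrm d\varphi)\circ\mathfrak C_\varphi-\mathrm d\varphi(\mathrm{div}\,\mathfrak C_\varphi)$$ be the $\sigma_2$-tension field, where $\mathrm{trace}(\nabla\mathrm d\varphi)\circ\mathfrak C_\varphi=\sum_i(\nabla\mathrm d\varphi)(e_i,\mathfrak C_\varphi e_i)$ and $\mathrm{div}\,\mathfrak C_\varphi=\sum_i(\nabla_{e_i}\mathfrak C_\varphi)e_i$ for a local orthonormal frame $(e_i)$. The map $\varphi$ is harmonic if $\tau(\varphi)=0$, $\sigma_2$-critical if $\tau_{\sigma_2}(\varphi)=0$, and $\sigma_{1,2}$-critical if $\tau(\varphi)+K\tau_{\sigma_2}(\varphi)=0$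 (these are the Euler-Lagrange equations of $\mathcal E_{\sigma_1}$, $\mathcal E_{\sigma_2}$, $\mathcal E_{\sigma_{1,2}}$). ''With respect to a metric $g'$ on $M$'' means that these notions are computed with $g'$ in place of $g$ and the metric $h$ on $N$ unchanged. A submersion $\varphi:(M,g)\to(N,h)$ is horizontally conformal with dilation $\lambda:M\to(0,\infty)$ if $(\varphi^*h)|_{\mathcal H\times\mathcal H}=\lambda^2\,g|_{\mathcal H\times\mathcal H}$, where $\mathcal H=(\ker\mathrm d\varphi)^\perp$. A submersive harmonic morphism with dilation $\lambda$ is a horizontally conformal submersion with dilation $\lambda$ that is also harmonic. $g^{\mathcal H}$ and $g^{\mathcal V}$ denote the horizontal and vertical parts of $g$, i.e. $g=g^{\mathcal H}+g^{\mathcal V}$ with $g^{\mathcal H}(X,Y)=g(X^{\mathcal H},Y^{\mathcal H})$ and $g^{\mathcal V}(X,Y)=g(X^{\mathcal V},Y^{\mathcal V})$. For a function $f$, $\mathrm{grad}^{\mathcal H}f$ is the $\mathcal H$-component of the $g$-gradient of $f$. For a smooth function $\rho:M\to(0,\infty)$, the metric biconformally related to $g$ (with respect to $\mathcal V$) is $g_\rho=\rho^{-2}g^{\mathcal H}+\rho^{\frac{2n-4}{m-n}}g^{\mathcal V}$. *)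

(* Defs.v *)
From HB Require Import structures.
From mathcomp Require Import all_boot all_order all_algebra.
From mathcomp Require Import all_classical all_reals all_analysis.

Set Implicit Arguments.
Unset Strict Implicit.
Unset Printing Implicit Defensive.

Import Order.TTheory GRing.Theory Num.Theory.
Import numFieldNormedType.Exports.
Local Open Scope classical_set_scope.
Local Open Scope ring_scope.

(* Conventions.  A tangent vector at a point p of an m-manifold is represented
   in a chart around p by the row vector X of its components on the coordinate
   fields d/dx_a; linear maps act on the right, X |-> X *m A, so row a of the
   matrix of a linear map is the image of d/dx_a.  Tensor fields are families
   of components indexed by the charts; components are functions on the
   manifold, and are only meaningful on the domain of the chart. *)

Section Smooth.
Context {R : realType} {m : nat}.

Fixpoint Ck (k : nat) (U : set 'rV[R]_m) (f : 'rV[R]_m -> R) : Prop :=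
  if k is k'.+1 then
    (forall x, U x -> differentiable f x) /\
    (forall a : 'I_m, Ck k' U ('D_(delta_mx 0 a) f))
  else forall x, U x -> {for x, continuous f}.

(* Meant for open U. *)
Definition Cinfty (U : set 'rV[R]_m) (f : 'rV[R]_m -> R) : Prop :=
  forall k, Ck k U f.

End Smooth.

(* The atlas need not be maximal. *)
Record manifold (R : realType) (m : nat) := Manifold {
  carrier :> topologicalType ;
  chart : Type ;
  cdom : chart -> set carrier ;
  cmap : chart -> carrier -> 'rV[R]_m ;
  cinv : chart -> 'rV[R]_m -> carrier ;
  manifold_hausdorff : hausdorff_space carrier ;
  manifold_second_countable : @second_countable carrier ;
  cdom_cover : forall p : carrier, exists c, cdom c p ;
  cdom_open : forall c, open (cdom c) ;
  cimg_open : forall c, open (cmap c @` cdom c) ;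
  cmapK : forall c p, cdom c p -> cinv c (cmap c p) = p ;
  cmap_continuous : forall c p, cdom c p -> {for p, continuous (cmap c)} ;
  cinv_continuous : forall c x, (cmap c @` cdom c) x ->
    {for x, continuous (cinv c)} ;
  transition_smooth : forall c c' (k : 'I_m),
    Cinfty (cmap c @` (cdom c `&` cdom c'))
           (fun x => cmap c' (cinv c x) 0 k) }.

Definition chart_at (R : realType) (m : nat) (M : manifold R m) (p : M) :
  chart M := projT1 (cid (cdom_cover p)).

Section OneManifold.
Context {R : realType} {m : nat} {M : manifold R m}.
Implicit Types (c : chart M) (p : M) (X Y : 'rV[R]_m).

(* Meant for open W. *)
Definition smooth_on (W : set M) (f : M -> R) : Prop :=
  forall c, Cinfty (cmap c @` (W `&` cdom c)) (f \o cinv c).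

Definition smooth_fun (f : M -> R) : Prop := smooth_on setT f.

(* The partial derivative (d f / d x_a)(p) in the chart c. *)
Definition pd c (a : 'I_m) (f : M -> R) p : R :=
  'D_(delta_mx 0 a) (f \o cinv c) (cmap c p).

Definition dirmx c X (k l : nat) (F : M -> 'M[R]_(k, l)) p : 'M[R]_(k, l) :=
  \matrix_(i, j) \sum_(a < m) X 0 a * pd c a (fun q => F q i j) p.

(* The components g(d/dx_a, d/dx_b) in each chart. *)
Definition cotensor2 := chart M -> M -> 'M[R]_m.

Definition inner (G : 'M[R]_m) X Y : R := (X *m G *m Y^T) 0 0.

Record riemannian (g : cotensor2) : Prop := Riemannian {
  riemannian_sym : forall c p, cdom c p -> (g c p)^T = g c p ;
  riemannian_pos : forall c p X, cdom c p -> X != 0 -> 0 < inner (g c p) X X ;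
  riemannian_smooth : forall c (a b : 'I_m),
    smooth_on (cdom c) (fun p => g c p a b) ;
  riemannian_change : forall c c' p, cdom c p -> cdom c' p ->
    let J := \matrix_(a, b) pd c a (fun q => cmap c' q 0 b) p : 'M[R]_m in
    g c p = J *m g c' p *m J^T }.

Definition scale (f : M -> R) (g : cotensor2) : cotensor2 :=
  fun c p => f p *: g c p.

Definition grad (g : cotensor2) c (f : M -> R) p : 'rV[R]_m :=
  (\row_a pd c a f p) *m invmx (g c p).

(* Entry (b, k) of christoffel g c a p is Gamma^k_{ab}: row b is the
   Levi-Civita derivative of d/dx_b along d/dx_a. *)
Definition christoffel (g : cotensor2) c (a : 'I_m) p : 'M[R]_m :=
  \matrix_(b, k) (2^-1 * \sum_(l < m) invmx (g c p) k l *
    (pd c a (fun q => g c q b l) p + pd c b (fun q => g c q a l) p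
     - pd c l (fun q => g c q a b) p)).

Definition conn (g : cotensor2) c X p : 'M[R]_m :=
  \sum_(a < m) X 0 a *: christoffel g c a p.

(* The covariant derivative along X of a field A of endomorphisms of TM. *)
Definition nabla_end (g : cotensor2) c X (A : M -> 'M[R]_m) p : 'M[R]_m :=
  dirmx c X A p + A p *m conn g c X p - conn g c X p *m A p.

Definition orthonormal (G : 'M[R]_m) (e : 'I_m -> 'rV[R]_m) : Prop :=
  forall i j, inner G (e i) (e j) = (i == j)%:R.

Definition div_end (g : cotensor2) c (A : M -> 'M[R]_m)
    (e : 'I_m -> 'rV[R]_m) p : 'rV[R]_m :=
  \sum_(i < m) e i *m nabla_end g c (e i) A p.

End OneManifold.

Arguments cotensor2 {R m} M.

Section Maps.
Context {R : realType} {m n : nat} {M : manifold R m} {N : manifold R n}.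
Implicit Types (g : cotensor2 M) (h : cotensor2 N) (phi : M -> N).
Implicit Types (c : chart M) (d : chart N) (p : M) (X Y : 'rV[R]_m).
Implicit Types (e : 'I_m -> 'rV[R]_m).

Definition smooth_map phi : Prop :=
  continuous phi /\
  forall d (k : 'I_n),
    smooth_on (phi @^-1` cdom d) (fun p => cmap d (phi p) 0 k).

(* The differential of phi at p, in the charts c around p, d around phi p. *)
Definition dmap phi c d p : 'M[R]_(m, n) :=
  \matrix_(a, k) pd c a (fun q => cmap d (phi q) 0 k) p.

(* The vector (nabla_X (d phi)) Y, where nabla is induced by the Levi-Civita
   connections of g and h on the bundle T^*M (x) phi^* TN. *)
Definition nabla_d g h phi c d p X Y : 'rV[R]_n :=
  Y *m (dirmx c X (dmap phi c d) p
        + dmap phi c d p *m conn h d (X *m dmap phi c d p) (phi p)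
        - conn g c X p *m dmap phi c d p).

(* The adjoint (d phi)^t of the differential, see dmap_adjP below. *)
Definition dmap_adj g h phi c d p : 'M[R]_(n, m) :=
  h d (phi p) *m (dmap phi c d p)^T *m invmx (g c p).

Definition cauchy_green g h phi c d p : 'M[R]_m :=
  dmap phi c d p *m dmap_adj g h phi c d p.

(* |d phi|^2 is the trace of the Cauchy-Green tensor, see
   tr_cauchy_green_frame below. *)
Definition energy_density g h phi c d p : R :=
  2^-1 * \tr (cauchy_green g h phi c d p).

(* In the next two definitions e is an orthonormal basis of the tangent space
   at p; the result does not depend on it. *)
Definition tension g h phi c d p e : 'rV[R]_n :=
  \sum_(i < m) nabla_d g h phi c d p (e i) (e i).

Definition tension2 g h phi c d p e : 'rV[R]_n :=
  2 *: (energy_density g h phi c d p *: tension g h phi c d p e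
        + grad g c (energy_density g h phi c d) p *m dmap phi c d p)
  - \sum_(i < m)
      nabla_d g h phi c d p (e i) (e i *m cauchy_green g h phi c d p)
  - div_end g c (cauchy_green g h phi c d) e p *m dmap phi c d p.

Definition vanishes g phi
    (F : chart M -> chart N -> M -> ('I_m -> 'rV[R]_m) -> 'rV[R]_n) : Prop :=
  forall c d p e, cdom c p -> cdom d (phi p) -> orthonormal (g c p) e ->
    F c d p e = 0.

Definition harmonic g h phi : Prop := vanishes g phi (tension g h phi).

Definition sigma2_critical g h phi : Prop :=
  vanishes g phi (tension2 g h phi).

Definition sigma12_critical (K : R) g h phi : Prop :=
  vanishes g phi (fun c d p e =>
    tension g h phi c d p e + K *: tension2 g h phi c d p e).

Definition submersion phi : Prop :=
  smooth_map phi /\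
  forall c d p, cdom c p -> cdom d (phi p) -> row_full (dmap phi c d p).

(* Row spaces of the following matrices: the kernel of the differential and
   its g-orthogonal complement.  The kernel does not depend on the chart of N
   around phi p. *)
Definition ver phi c p : 'M[R]_m := kermx (dmap phi c (chart_at (phi p)) p).

Definition hor g phi c p : 'M[R]_m := kermx (g c p *m (ver phi c p)^T).

(* X *m hproj is the horizontal component of X, X *m vproj the vertical one. *)
Definition hproj g phi c p : 'M[R]_m := proj_mx (hor g phi c p) (ver phi c p).

Definition vproj g phi c p : 'M[R]_m := proj_mx (ver phi c p) (hor g phi c p).

Definition hpart g phi : cotensor2 M := fun c p =>
  hproj g phi c p *m g c p *m (hproj g phi c p)^T.

Definition vpart g phi : cotensor2 M := fun c p =>
  vproj g phi c p *m g c p *m (vproj g phi c p)^T.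

Definition gradH g phi c (f : M -> R) p : 'rV[R]_m :=
  grad g c f p *m hproj g phi c p.

Definition horizontally_conformal g h phi (lam : M -> R) : Prop :=
  [/\ submersion phi, smooth_fun lam, (forall p, 0 < lam p) &
    forall c d p X Y, cdom c p -> cdom d (phi p) ->
      (X <= hor g phi c p)%MS -> (Y <= hor g phi c p)%MS ->
      inner (h d (phi p)) (X *m dmap phi c d p) (Y *m dmap phi c d p)
      = lam p ^+ 2 * inner (g c p) X Y].

Definition submersive_harmonic_morphism g h phi (lam : M -> R) : Prop :=
  horizontally_conformal g h phi lam /\ harmonic g h phi.

Definition biconformal g phi (rho : M -> R) : cotensor2 M := fun c p =>
  rho p ^- 2 *: hpart g phi c p
  + rho p `^ ((2 * n%:R - 4) / (m%:R - n%:R)) *: vpart g phi c p.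

Lemma riemannian_unit g c p : riemannian g -> cdom c p -> g c p \in unitmx.
Proof.
move=> gR cp; rewrite -row_free_unit -kermx_eq0; apply/eqP/row_matrixP => i.
rewrite row0; apply/eqP/negP => /negP X0.
have := riemannian_pos gR cp X0.
by rewrite /inner -row_mul mulmx_ker row0 mul0mx mxE ltxx.
Qed.

Lemma dmap_adjP g h phi c d p (W : 'rV[R]_n) X :
  riemannian g -> cdom c p ->
  inner (g c p) (W *m dmap_adj g h phi c d p) X
  = inner (h d (phi p)) W (X *m dmap phi c d p).
Proof.
move=> gR cp; rewrite /inner /dmap_adj !mulmxA mulmxKV ?trmx_mul ?mulmxA //.
exact: riemannian_unit gR cp.
Qed.

Lemma tr_cauchy_green_frame g h phi c d p e :
  riemannian g -> cdom c p -> orthonormal (g c p) e ->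
  \tr (cauchy_green g h phi c d p)
  = \sum_(i < m) inner (h d (phi p)) (e i *m dmap phi c d p)
                                     (e i *m dmap phi c d p).
Proof.
move=> gR cp oe; pose E := \matrix_i e i.
have gU := riemannian_unit gR cp.
have EGE : E *m g c p *m E^T = 1%:M.
  apply/matrixP => i j; rewrite mxE [RHS]mxE -oe /inner mxE.
  apply: eq_bigr => k _; congr (_ * _); last by rewrite !mxE.
  by rewrite !mxE; apply: eq_bigr => l _; rewrite !mxE.
have EE : E^T *m E = invmx (g c p).
  have := mulmx1C EGE; rewrite mulmxA => H.
  by rewrite -[LHS](mulmxK gU) H mul1mx.
rewrite /cauchy_green /dmap_adj -EE !mulmxA mxtrace_mulC !mulmxA /mxtrace.
apply: eq_bigr => i _; rewrite /inner trmx_mul !mulmxA.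
rewrite [LHS]mxE [RHS]mxE; apply: eq_bigr => k _; congr (_ * _); last first.
  by rewrite !mxE.
rewrite -[e i](rowK e i) -/E -!row_mul !mxE.
by apply: eq_bigr => l _; rewrite mxE.
Qed.

End Maps.

(* Main.v *)
(** Write D for the matrix of dphi and S = g^-1 D.  If the Cauchy-Green tensor
    satisfies C D = mu D near a point, then the two trace terms of the
    sigma_2-tension field add up, by the Leibniz rule applied to C D = mu D,
    to dphi(grad mu) + mu tau; as tr C = n mu this gives
      tau_sigma2 = (n - 1) (mu tau + dphi(grad mu)).
    Horizontal conformality yields this with mu = lam^2, and exhibits the
    horizontal projection as the smooth field P = lam^-2 C.  For the metric
    g' = u g^H + v g^V one has g'^-1 D = u^-1 S and mu' = lam^2 / u, and the
    divergence form of the tension field gives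
      tau' = u^-1 (tau + dphi(grad log (u^(n/2 - 1) v^((m - n)/2)))).
    With tau = 0, each claim is a computation of logarithmic derivatives. *)

Require Import Defs.
From HB Require Import structures.
From mathcomp Require Import all_boot all_order all_algebra.
From mathcomp Require Import all_classical all_reals all_analysis.
From mathcomp Require Import ring.

Set Implicit Arguments.
Unset Strict Implicit.
Unset Printing Implicit Defensive.

Import Order.TTheory GRing.Theory Num.Theory.
Import numFieldNormedType.Exports.
Local Open Scope classical_set_scope.
Local Open Scope ring_scope.

(** * Calculus of partial derivatives in a chart *)

Section PartialDerivatives.
Context {R : realType} {m : nat} {M : manifold R m}.
Variables (c : chart M) (p : M).
Hypothesis cp : cdom c p.

(** Derivability along the coordinate directions only: it is stable under sums, products and
    inverses, whereas real powers and compositions below start from full differentiability. *)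
Definition pdiff (f : M -> R) : Prop :=
  forall a : 'I_m, derivable (f \o cinv c) (cmap c p) (delta_mx 0 a).

Lemma near_cinv (P : set M) :
  (\forall q \near p, P q) -> \forall x \near cmap c p, P (cinv c x).
Proof.
move=> Pp; have : {for cmap c p, continuous (cinv c)}.
  by apply: cinv_continuous; exists p.
by move=> /(_ P); rewrite /= /nbhs /= cmapK //; apply.
Qed.

Lemma near_cdom : \forall q \near p, cdom c q.
Proof. by apply: open_nbhs_nbhs; split => //; exact: cdom_open. Qed.

(** A partial derivative depends only on the germ at [p]. Identities between components hold only
    where the charts are defined, so they are differentiated through this lemma. *)
Lemma near_pd (f f' : M -> R) a :
  (\forall q \near p, f q = f' q) -> pd c a f p = pd c a f' p.
Proof. by move=> ff'; apply: near_eq_derive; exact: near_cinv ff'. Qed.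

Lemma near_pdiff (f f' : M -> R) :
  (\forall q \near p, f q = f' q) -> pdiff f -> pdiff f'.
Proof.
by move=> ff' df a; apply: near_eq_derivable (df a); exact: near_cinv ff'.
Qed.

Lemma pdiff_cst k : pdiff (fun=> k).
Proof. by move=> a; exact: derivable_cst. Qed.

Lemma pd_cst a k : pd c a (fun=> k) p = 0.
Proof. exact: derive_cst. Qed.

Lemma pdiffD f f' : pdiff f -> pdiff f' -> pdiff (fun q => f q + f' q).
Proof. by move=> df df' a; exact: derivableD (df a) (df' a). Qed.

Lemma pdD a f f' : pdiff f -> pdiff f' ->
  pd c a (fun q => f q + f' q) p = pd c a f p + pd c a f' p.
Proof. by move=> df df'; exact: deriveD (df a) (df' a). Qed.

Lemma pdiffM f f' : pdiff f -> pdiff f' -> pdiff (fun q => f q * f' q).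
Proof. by move=> df df' a; exact: derivableM (df a) (df' a). Qed.

Lemma pdM a f f' : pdiff f -> pdiff f' ->
  pd c a (fun q => f q * f' q) p = f p * pd c a f' p + pd c a f p * f' p.
Proof.
move=> df df'; rewrite [RHS](_ : _ = f (cinv c (cmap c p)) * pd c a f' p
  + f' (cinv c (cmap c p)) * pd c a f p); last by rewrite cmapK // [_ * f' p]mulrC.
exact: deriveM (df a) (df' a).
Qed.

Lemma pdiffV f : f p != 0 -> pdiff f -> pdiff (fun q => (f q)^-1).
Proof. by move=> f0 df a; apply: derivableV (df a); rewrite /= cmapK. Qed.

Lemma pdV a f : f p != 0 -> pdiff f ->
  pd c a (fun q => (f q)^-1) p = - f p ^- 2 * pd c a f p.
Proof.
move=> f0 df; have fE : (f \o cinv c) (cmap c p) = f p by rewrite /= cmapK.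
by rewrite -fE; apply: deriveV (df a); rewrite fE.
Qed.

Lemma pdiffX f k : pdiff f -> pdiff (fun q => f q ^+ k).
Proof.
move=> df; elim: k => [|k IH].
  by under eq_fun do rewrite expr0; exact: pdiff_cst.
by under eq_fun do rewrite exprS; exact: pdiffM.
Qed.

Lemma pdX a f k : pdiff f ->
  pd c a (fun q => f q ^+ k) p = k%:R * f p ^+ k.-1 * pd c a f p.
Proof.
move=> df; elim: k => [|k Ek].
  by under eq_fun do rewrite expr0; rewrite pd_cst !mul0r.
under eq_fun do rewrite exprS.
rewrite pdM //; last exact: pdiffX.
(* At [k = 0] the truncated exponent [k.-1] is 0 and not -1; the factor [k%:R] makes this
   harmless. *)
rewrite Ek; case: k {Ek} => [|k]; first by rewrite !expr0; ring.
by rewrite /= -[in RHS]natr1 exprS; ring.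
Qed.

Lemma pdiff_sum I (r : seq I) (P : pred I) (F : I -> M -> R) :
  (forall i, pdiff (F i)) -> pdiff (fun q => \sum_(i <- r | P i) F i q).
Proof.
move=> dF; elim: r => [|i r IH].
  by under eq_fun do rewrite big_nil; exact: pdiff_cst.
under eq_fun do rewrite big_cons; case: (P i) => //.
exact: pdiffD (dF i) IH.
Qed.

Lemma pd_sum a I (r : seq I) (F : I -> M -> R) :
  (forall i, pdiff (F i)) ->
  pd c a (fun q => \sum_(i <- r) F i q) p = \sum_(i <- r) pd c a (F i) p.
Proof.
move=> dF; elim: r => [|i r IH].
  by under eq_fun do rewrite big_nil; rewrite big_nil pd_cst.
under eq_fun do rewrite big_cons.
by rewrite big_cons -IH pdD //; exact: pdiff_sum.
Qed.

Lemma pdiff_prod I (r : seq I) (F : I -> M -> R) :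
  (forall i, pdiff (F i)) -> pdiff (fun q => \prod_(i <- r) F i q).
Proof.
move=> dF; elim: r => [|i r IH].
  by under eq_fun do rewrite big_nil; exact: pdiff_cst.
by under eq_fun do rewrite big_cons; exact: pdiffM (dF i) IH.
Qed.

(** Chain rule for total differentials, with the one-variable derivative of the power function at
    the positive number [f p]. *)
Lemma is_derive_powR (f : M -> R) (s : R) (a : 'I_m) :
  0 < f p -> differentiable (f \o cinv c) (cmap c p) ->
  is_derive (cmap c p) (delta_mx 0 a) ((fun q => f q `^ s) \o cinv c)
    (s * f p `^ (s - 1) * pd c a f p).
Proof.
move=> f0 df.
have fE : (f \o cinv c) (cmap c p) = f p by rewrite /= cmapK.
have dP : is_derive (f p) 1 (@powR R ^~ s) (s * f p `^ (s - 1)).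
  exact: is_derive1_powR.
have dP' : differentiable (@powR R ^~ s) ((f \o cinv c) (cmap c p)).
  by rewrite fE; apply/derivable1_diffP; case: dP.
have dcmp : differentiable ((@powR R ^~ s) \o (f \o cinv c)) (cmap c p).
  exact: differentiable_comp.
have -> : s * f p `^ (s - 1) * pd c a f p
    = 'd (@powR R ^~ s \o (f \o cinv c)) (cmap c p) (delta_mx 0 a).
  rewrite diff_comp // /= -(deriveE _ df) -/(pd c a f p) cmapK //.
  have dP1 : derivable (@powR R ^~ s) (f p) 1 by case: dP.
  rewrite (deriv1E dP1) derive1E; case: dP => _ ->.
  by rewrite mulrC.
rewrite -deriveE //; apply: derivableP; exact: diff_derivable.
Qed.

Lemma pdiff_powR (f : M -> R) (s : R) :
  0 < f p -> differentiable (f \o cinv c) (cmap c p) ->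
  pdiff (fun q => f q `^ s).
Proof. by move=> f0 df a; case: (is_derive_powR s a f0 df). Qed.

Lemma pd_powR a (f : M -> R) (s : R) :
  0 < f p -> differentiable (f \o cinv c) (cmap c p) ->
  pd c a (fun q => f q `^ s) p = s * f p `^ (s - 1) * pd c a f p.
Proof. by move=> f0 df; case: (is_derive_powR s a f0 df). Qed.

End PartialDerivatives.

(** * Chain rule through finitely many coordinate functions *)

Section RowChainRule.
Context {R : realType} {m n : nat}.
Implicit Types (f : 'I_n -> 'rV[R]_m -> R) (F : 'rV[R]_n -> R).

Lemma differentiable_row f x : (forall k, differentiable (f k) x) ->
  differentiable (fun y => \row_k f k y) x.
Proof.
move=> df; rewrite (_ : (fun y => _) =
    \sum_(k < n) (fun y => f k y *: (delta_mx 0 k : 'rV[R]_n))); last first.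
  apply/funext => y; rewrite fct_sumE [LHS]row_sum_delta.
  by apply: eq_bigr => k _; rewrite mxE.
by apply: differentiable_sum => k; exact: differentiableZl.
Qed.

Lemma is_derive_comp_row f F x v : (forall k, differentiable (f k) x) ->
  differentiable F (\row_k f k x) ->
  is_derive x v (fun y => F (\row_k f k y))
    (\sum_k 'D_v (f k) x * 'D_(delta_mx 0 k) F (\row_k f k x)).
Proof.
move=> df dF; have dr := differentiable_row df.
have dc : differentiable (F \o (fun y => \row_k f k y)) x.
  exact: differentiable_comp.
split; first exact: diff_derivable.
rewrite (deriveE v dc) diff_comp //= -(deriveE _ dr).
rewrite derive_mx; last exact: diff_derivable.
rewrite [X in 'd F _ X]row_sum_delta raddf_sum; apply: eq_bigr => k _ /=.
rewrite linearZ /= -(deriveE _ dF) mxE; congr (_ * _).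
by congr ('D_v _ x); apply/funext => y; rewrite mxE.
Qed.

End RowChainRule.

(** * Smooth functions and maps read in charts *)

Section Smoothness.
Context {R : realType} {m n : nat} {M : manifold R m} {N : manifold R n}.

Lemma smooth_differentiable (W : set M) f c p :
  smooth_on W f -> W p -> cdom c p -> differentiable (f \o cinv c) (cmap c p).
Proof. by move=> sf Wp cp; have [+ _] := sf c 1%N; apply; exists p. Qed.

Lemma smooth_pdiff (W : set M) f c p :
  smooth_on W f -> W p -> cdom c p -> pdiff c p f.
Proof.
by move=> sf Wp cp a; apply: diff_derivable; exact: smooth_differentiable sf _ _.
Qed.

(** The second-order clause of [Cinfty] concerns the derivative taken in the chart; it agrees with
    [pd c a f \o cinv c] only on the image of the chart, which is open, so the germs coincide. *)
Lemma smooth_pdiff_pd (W : set M) f c p a :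
  smooth_on W f -> W p -> cdom c p -> pdiff c p (pd c a f).
Proof.
move=> sf Wp cp b.
have [_ /(_ a) [+ _]] := sf c 2%N => /(_ (cmap c p)) dd.
have : derivable ('D_(delta_mx 0 a) (f \o cinv c)) (cmap c p) (delta_mx 0 b).
  by apply: diff_derivable; apply: dd; exists p.
apply: near_eq_derivable.
have : \forall x \near cmap c p, (cmap c @` cdom c) x.
  by apply: open_nbhs_nbhs; split; [exact: cimg_open|exists p].
apply: filterS => _ [q cq <-].
by rewrite /= /pd cmapK.
Qed.

Variables (phi : M -> N) (c : chart M) (d : chart N) (p : M).
Hypotheses (sphi : smooth_map phi) (cp : cdom c p) (dp : cdom d (phi p)).

Lemma near_charts : \forall q \near p, cdom c q /\ cdom d (phi q).
Proof.
apply: filterI; first exact: near_cdom.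
by apply: sphi.1; apply: open_nbhs_nbhs; split => //; exact: cdom_open.
Qed.

Lemma pdiff_dmap i j : pdiff c p (fun q => dmap phi c d q i j).
Proof.
under eq_fun do rewrite mxE.
exact: smooth_pdiff_pd (sphi.2 d j) dp cp.
Qed.

(** Near [p] the map stays in the domain of [d], so [F \o phi] factors through [F \o cinv d] and the
    coordinate functions of [phi]. *)
Lemma is_derive_comp_map F a :
  differentiable (F \o cinv d) (cmap d (phi p)) ->
  is_derive (cmap c p) (delta_mx 0 a) ((F \o phi) \o cinv c)
    (\sum_k dmap phi c d p a k * pd d k F (phi p)).
Proof.
move=> dF; pose f k x : R := cmap d (phi (cinv c x)) 0 k.
have fE x : \row_k f k x = cmap d (phi (cinv c x)).
  by apply/rowP => k; rewrite mxE.
have df k : differentiable (f k) (cmap c p).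
  exact: smooth_differentiable (sphi.2 d k) dp cp.
have dF' : differentiable (F \o cinv d) (\row_k f k (cmap c p)).
  by rewrite fE cmapK.
have := is_derive_comp_row (delta_mx 0 a) df dF'.
rewrite fE cmapK // => H.
under eq_bigr do rewrite mxE.
apply: near_eq_is_derive H.
have := near_cinv cp near_charts; apply: filterS => x [_ dx].
by rewrite fE /= cmapK.
Qed.

Lemma pdiff_comp_map (F : N -> R) :
  differentiable (F \o cinv d) (cmap d (phi p)) -> pdiff c p (F \o phi).
Proof. by move=> dF a; case: (is_derive_comp_map a dF). Qed.

End Smoothness.

(** The factor [J] is the Jacobian of the transition map. This frees [ver] from the particular chart
    [chart_at (phi p)] in its definition. *)
Lemma dmap_change (R : realType) (m n : nat) (M : manifold R m)
    (N : manifold R n) (phi : M -> N) (c : chart M) (d d' : chart N) (p : M) :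
  smooth_map phi -> cdom c p -> cdom d (phi p) -> cdom d' (phi p) ->
  exists J, dmap phi c d' p = dmap phi c d p *m J.
Proof.
move=> sphi cp dp dp'.
exists (\matrix_(k, l) pd d k (fun y => cmap d' y 0 l) (phi p)).
apply/matrixP => a l; rewrite mxE.
have dF : differentiable ((fun y => cmap d' y 0 l) \o cinv d) (cmap d (phi p)).
  have [+ _] := transition_smooth d d' l 1%N; apply; exists (phi p) => //.
have [_] := is_derive_comp_map sphi cp dp a dF.
rewrite mxE => E; rewrite [LHS]E.
by apply: eq_bigr => k _; rewrite !mxE.
Qed.

(** * Entrywise derivatives of matrix-valued functions *)

Section MatrixDerivatives.
Context {R : realType} {m : nat} {M : manifold R m}.
Variables (c : chart M) (p : M).
Hypothesis cp : cdom c p.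

Definition pdmx a k l (A : M -> 'M[R]_(k, l)) : 'M[R]_(k, l) :=
  \matrix_(i, j) pd c a (fun q => A q i j) p.

Definition pdiffmx k l (A : M -> 'M[R]_(k, l)) : Prop :=
  forall i j, pdiff c p (fun q => A q i j).

Lemma dirmxE X k l (A : M -> 'M[R]_(k, l)) :
  dirmx c X A p = \sum_a X 0 a *: pdmx a A.
Proof.
apply/matrixP => i j; rewrite mxE summxE.
by apply: eq_bigr => a _; rewrite !mxE.
Qed.

Lemma near_pdmx a k l (A A' : M -> 'M[R]_(k, l)) :
  (\forall q \near p, A q = A' q) -> pdmx a A = pdmx a A'.
Proof.
move=> AA'; apply/matrixP => i j; rewrite !mxE; apply: near_pd => //.
by apply: filterS AA' => q ->.
Qed.

Lemma near_pdiffmx k l (A A' : M -> 'M[R]_(k, l)) :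
  (\forall q \near p, A q = A' q) -> pdiffmx A -> pdiffmx A'.
Proof.
by move=> AA' dA i j; apply: near_pdiff (dA i j) => //; apply: filterS AA' => q ->.
Qed.

Lemma pdiffmx_cst k l (A : 'M[R]_(k, l)) : pdiffmx (fun=> A).
Proof. by move=> i j; exact: pdiff_cst. Qed.

Lemma pdmx_cst a k l (A : 'M[R]_(k, l)) : pdmx a (fun=> A) = 0.
Proof. by apply/matrixP => i j; rewrite !mxE pd_cst. Qed.

Lemma pdiffmx_tr k l (A : M -> 'M[R]_(k, l)) :
  pdiffmx A -> pdiffmx (fun q => (A q)^T).
Proof. by move=> dA i j; under eq_fun do rewrite mxE; exact: dA. Qed.

Lemma pdiffmxD k l (A B : M -> 'M[R]_(k, l)) :
  pdiffmx A -> pdiffmx B -> pdiffmx (fun q => A q + B q).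
Proof.
by move=> dA dB i j; under eq_fun do rewrite mxE; apply: pdiffD; [exact: dA|exact: dB].
Qed.

Lemma pdmxD a k l (A B : M -> 'M[R]_(k, l)) : pdiffmx A -> pdiffmx B ->
  pdmx a (fun q => A q + B q) = pdmx a A + pdmx a B.
Proof.
move=> dA dB; apply/matrixP => i j; rewrite !mxE.
by under eq_fun do rewrite mxE; rewrite pdD.
Qed.

Lemma pdiffmxM k l r (A : M -> 'M[R]_(k, l)) (B : M -> 'M[R]_(l, r)) :
  pdiffmx A -> pdiffmx B -> pdiffmx (fun q => A q *m B q).
Proof.
move=> dA dB i j; under eq_fun do rewrite mxE.
by apply: pdiff_sum => s; exact: pdiffM.
Qed.

Lemma pdmxM a k l r (A : M -> 'M[R]_(k, l)) (B : M -> 'M[R]_(l, r)) :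
  pdiffmx A -> pdiffmx B ->
  pdmx a (fun q => A q *m B q) = pdmx a A *m B p + A p *m pdmx a B.
Proof.
move=> dA dB; apply/matrixP => i j; rewrite !mxE -big_split /=.
under eq_fun do rewrite mxE; rewrite pd_sum => [|s]; last exact: pdiffM.
by apply: eq_bigr => s _; rewrite pdM // !mxE addrC.
Qed.

Lemma pdiffmxZ k l (f : M -> R) (A : M -> 'M[R]_(k, l)) :
  pdiff c p f -> pdiffmx A -> pdiffmx (fun q => f q *: A q).
Proof. by move=> df dA i j; under eq_fun do rewrite mxE; exact: pdiffM. Qed.

Lemma pdmxZ a k l (f : M -> R) (A : M -> 'M[R]_(k, l)) :
  pdiff c p f -> pdiffmx A ->
  pdmx a (fun q => f q *: A q) = pd c a f p *: A p + f p *: pdmx a A.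
Proof.
move=> df dA; apply/matrixP => i j; rewrite !mxE.
by under eq_fun do rewrite mxE; rewrite pdM // addrC.
Qed.

Lemma pd_mxtrace a k (A : M -> 'M[R]_k) : pdiffmx A ->
  pd c a (fun q => \tr (A q)) p = \tr (pdmx a A).
Proof.
move=> dA; rewrite /mxtrace pd_sum; last by move=> i; exact: dA.
by apply: eq_bigr => i _; rewrite mxE.
Qed.

Lemma pdiff_det k (A : M -> 'M[R]_k) : pdiffmx A -> pdiff c p (fun q => \det (A q)).
Proof.
move=> dA; apply: pdiff_sum => s; apply: pdiffM; [exact: pdiff_cst|].
by apply: pdiff_prod => i; exact: dA.
Qed.

(** By Cramer's rule the inverse is a quotient of polynomials in the entries. *)
Lemma pdiffmx_inv k (A : M -> 'M[R]_k) :
  (\forall q \near p, A q \in unitmx) -> pdiffmx A ->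
  pdiffmx (fun q => invmx (A q)).
Proof.
move=> uA dA; apply: (@near_pdiffmx _ _ (fun q => (\det (A q))^-1 *: \adj (A q))).
  by apply: filterS uA => q uq; rewrite /invmx uq.
apply: pdiffmxZ.
  apply: pdiffV => //; last exact: pdiff_det.
  by rewrite -unitfE; exact: (nbhs_singleton uA).
move=> i j; under eq_fun do rewrite mxE; apply: pdiffM; [exact: pdiff_cst|].
apply: pdiff_det => i' j'; under eq_fun do rewrite !mxE; exact: dA.
Qed.

(** Differentiate [A q *m invmx (A q) = 1%:M]. *)
Lemma pdmx_inv a k (A : M -> 'M[R]_k) :
  (\forall q \near p, A q \in unitmx) -> pdiffmx A ->
  pdmx a (fun q => invmx (A q))
  = - (invmx (A p) *m pdmx a A *m invmx (A p)).
Proof.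
move=> uA dA; have dV := pdiffmx_inv uA dA.
have up : A p \in unitmx by exact: (nbhs_singleton uA).
have : pdmx a (fun q => A q *m invmx (A q)) = 0.
  rewrite -(pdmx_cst a (1%:M : 'M[R]_k)); apply: near_pdmx.
  by apply: filterS uA => q uq; rewrite mulmxV.
rewrite pdmxM // => /eqP; rewrite addrC addr_eq0 => /eqP E.
by rewrite -[LHS](mulKmx up) E mulmxN mulmxA.
Qed.

End MatrixDerivatives.

(** * Existence of orthonormal bases, and contractions over them *)

Section Frames.
Context {R : realType}.

(** Induction on the size: the Schur complement [C'] of the first diagonal entry is again symmetric
    and positive definite. *)
Lemma Gram_Schmidt k (G : 'M[R]_k) : G^T = G ->
  (forall X : 'rV_k, X != 0 -> 0 < inner G X X) ->
  exists E : 'M[R]_k, E *m G *m E^T = 1%:M.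
Proof.
elim: k G => [G _ _|k IH]; first by exists 0; apply/matrixP => -[].
rewrite -[k.+1]/(1 + k)%N => G symG posG.
pose b := ursubmx G; pose C := drsubmx G; pose a := G 0 0.
have GE : G = block_mx a%:M b b^T C.
  rewrite -[LHS]submxK; congr block_mx; last by rewrite /b trmx_ursub symG.
  apply/matrixP => i j; rewrite !ord1 !mxE /= mulr1n.
  by congr (G _ _); apply/val_inj.
have a0 : 0 < a.
  have d0 : (delta_mx 0 0 : 'rV[R]_(1 + k)) != 0.
    apply/eqP => /matrixP /(_ 0 0); rewrite !mxE eqxx => /eqP.
    by rewrite oner_eq0.
  have := posG _ d0; rewrite /inner -rowE trmx_delta -colE.
  by rewrite !mxE.
pose C' := C - a^-1 *: (b^T *m b).
have symC : C^T = C by rewrite /C trmx_drsub symG.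
have symC' : C'^T = C' by rewrite /C' linearB linearZ /= trmx_mul trmxK symC.
have posC' (X : 'rV_k) : X != 0 -> 0 < inner C' X X.
  (* [Y] lifts [X] to a vector [G]-orthogonal to the first basis vector; on such vectors [G]
     restricts to [C']. *)
  move=> X0; pose Y := row_mx (- a^-1 *: (X *m b^T)) X.
  have Y0 : Y != 0.
    apply: contraNneq X0 => Y0; have := congr1 rsubmx Y0.
    by rewrite row_mxKr linear0 => ->.
  have -> : inner C' X X = inner G Y Y; last exact: posG.
  rewrite /inner /Y GE mul_row_block mul_mx_scalar scalerA mulrN divff ?gt_eqF //.
  rewrite scaleN1r addNr tr_row_mx mul_row_col mul0mx add0r; congr (_ 0 0).
  rewrite mulmxBr -scalemxAr mulmxA; congr (_ *m _).
  by rewrite -scalemxAl scaleNr addrC.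
have [E' E'P] := IH _ symC' posC'.
pose s := (Num.sqrt a)^-1.
have ss : s * s = a^-1 by rewrite -invfM -expr2 sqr_sqrtr // ltW.
(* First the normalised first basis vector, then the orthogonal lifts of the rows of [E']. *)
exists (block_mx s%:M 0 (- a^-1 *: (E' *m b^T)) E').
rewrite GE mulmx_block tr_block_mx mulmx_block !trmx0 !mulmx0 !mul0mx !addr0.
rewrite !mul_mx_scalar !mul_scalar_mx !tr_scalar_mx scalerA mulrN divff ?gt_eqF //.
rewrite scaleN1r addNr !mul0mx add0r.
rewrite (_ : - a^-1 *: (E' *m b^T) *m b + E' *m C = E' *m C'); last first.
  by rewrite mulmxBr addrC scaleNr mulNmx -scalemxAl -scalemxAr mulmxA.
rewrite E'P linearZ /= trmx_mul trmxK -!scalemxAl mul_scalar_mx !scalerA.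
rewrite mul_scalar_mx !scalerA scale_scalar_mx -mulrA ss divff ?gt_eqF //.
by rewrite mulrN mulrAC divff ?gt_eqF // mul1r scaleNr addNr -scalar_mx_block.
Qed.

Lemma orthonormalP k (G : 'M[R]_k) e :
  Defs.orthonormal G e <-> (\matrix_i e i) *m G *m (\matrix_i e i)^T = 1%:M.
Proof.
have E i j : ((\matrix_i e i) *m G *m (\matrix_i e i)^T) i j = inner G (e i) (e j).
  rewrite /inner -[in RHS](rowK e i) -row_mul.
  rewrite !mxE; apply: eq_bigr => l _; congr (_ * _); first by rewrite !mxE.
  by rewrite !mxE.
split=> [oe|H i j]; first by apply/matrixP => i j; rewrite E oe mxE.
by rewrite -E H mxE.
Qed.

Lemma ex_orthonormal k (G : 'M[R]_k) : G^T = G ->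
  (forall X : 'rV_k, X != 0 -> 0 < inner G X X) ->
  exists e, Defs.orthonormal G e.
Proof.
move=> symG posG; have [E EP] := Gram_Schmidt symG posG.
exists (fun i => row i E); apply/orthonormalP.
by rewrite (_ : \matrix_i row i E = E) //; apply/row_matrixP => i; rewrite rowK.
Qed.

Lemma orthonormal_gram k (G : 'M[R]_k) e : Defs.orthonormal G e ->
  (\matrix_i e i)^T *m (\matrix_i e i) = invmx G.
Proof.
move=> /orthonormalP EGE; have H := mulmx1C EGE; rewrite mulmxA in H.
have [_ Gu] := mulmx1_unit H.
by rewrite -[LHS](mulmxK Gu) H mul1mx.
Qed.

(** A trace over an orthonormal basis is a contraction with the inverse metric, by
    [orthonormal_gram]; the basis disappears. *)
Lemma frame_sum k l (G : 'M[R]_k) e (B : 'I_k -> 'M[R]_(k, l)) :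
  Defs.orthonormal G e ->
  \sum_i \sum_a e i 0 a *: (e i *m B a) = \sum_a row a (invmx G) *m B a.
Proof.
move=> oe; rewrite exchange_big /=; apply: eq_bigr => a _.
rewrite -(orthonormal_gram oe) row_mul -mulmxA mulmx_sum_row.
by apply: eq_bigr => i _; rewrite row_mul rowK !mxE.
Qed.

End Frames.

(** * Divergence form of the tension field *)

Section Tension.
Context {R : realType} {m n : nat} {M : manifold R m} {N : manifold R n}.

(** The germ-level conditions behind the divergence form; for a modified metric they are read off
    its formula in one chart. *)
Definition regular_metric (g : cotensor2 M) (c : chart M) (p : M) : Prop :=
  [/\ \forall q \near p, g c q \in unitmx,
      \forall q \near p, (g c q)^T = g c q & pdiffmx c p (g c)].

(** The classical identity g^(ab) Gamma^k_(ab) = - (det g)^(-1/2) d_a ((det g)^(1/2) g^(ak)), with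
    the logarithmic derivative of det g written as a trace. *)
Lemma contracted_christoffel g (c : chart M) p :
  cdom c p -> regular_metric g c p ->
  \sum_a row a (invmx (g c p)) *m christoffel g c a p =
  - \sum_a (row a (pdmx c p a (fun q => invmx (g c q)))
            + (2^-1 * \tr (invmx (g c p) *m pdmx c p a (g c)))
              *: row a (invmx (g c p))).
Proof.
move=> cp [gu gs gd].
set V := invmx (g c p); pose P a := pdmx c p a (g c).
have symV : V^T = V by rewrite /V trmx_inv (nbhs_singleton gs).
have VC i j : V i j = V j i by rewrite -{1}symV mxE.
have symP a : (P a)^T = P a.
  apply/matrixP => i j; rewrite !mxE; apply: near_pd => //.
  by apply: filterS gs => q sq; rewrite -{1}sq mxE.
have PC a i j : P a i j = P a j i by rewrite -{1}symP mxE.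
apply/rowP => k; rewrite [RHS]mxE !summxE.
transitivity (2^-1 * (\sum_a \sum_b \sum_l V a b * V l k * P a b l
  + \sum_a \sum_b \sum_l V a b * V l k * P b a l
  - \sum_a \sum_b \sum_l V a b * V l k * P l a b)).
  rewrite -!big_split /= -sumrB mulr_sumr; apply: eq_bigr => a _.
  rewrite mxE -!big_split /= -sumrB mulr_sumr; apply: eq_bigr => b _.
  rewrite -!big_split /= -sumrB 2!mxE mulrCA mulr_sumr; congr (_ * _).
  by apply: eq_bigr => l _; rewrite !mxE (VC k l); ring.
(* Relabelling [a] and [b] makes the first two Christoffel terms equal; together they cancel the
   factor 1/2. The third term is the trace. *)
have -> : \sum_a \sum_b \sum_l V a b * V l k * P b a l
    = \sum_a \sum_b \sum_l V a b * V l k * P a b l.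
  rewrite exchange_big; apply: eq_bigr => a _; apply: eq_bigr => b _.
  by apply: eq_bigr => l _; rewrite (VC a b).
have -> : \sum_a \sum_b \sum_l V a b * V l k * P l a b
    = \sum_l \tr (V *m P l) * V l k.
  under eq_bigr do rewrite exchange_big.
  rewrite exchange_big; apply: eq_bigr => l _.
  rewrite /mxtrace mulr_suml; apply: eq_bigr => a _.
  rewrite mxE mulr_suml; apply: eq_bigr => b _.
  by rewrite (PC l a b) mulrAC.
have half (x : R) : 2^-1 * (x + x) = x by field.
rewrite mulrBr half.
rewrite mulr_sumr -sumrB -sumrN; apply: eq_bigr => a _.
rewrite pdmx_inv // -/V -/(P a) linearN -scaleN1r mxE mxE mxE [in RHS]mxE scaleN1r.
rewrite mxE mxE opprD opprK mulrA; congr (_ - _).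
rewrite exchange_big; apply: eq_bigr => l _; rewrite mxE mulr_suml.
by apply: eq_bigr => b _; rewrite mulrAC.
Qed.

Variables (h : cotensor2 N) (phi : M -> N).

(** Row [a] is dphi of the gradient of the coordinate x_a. A row of partial derivatives of f times
    this matrix is therefore dphi(grad f). *)
Definition sharp_dmap (g : cotensor2 M) c d p : 'M[R]_(m, n) :=
  invmx (g c p) *m dmap phi c d p.

(* The divergence form of the tension field: its second term is
   sum_a d_a (log (det g)^(1/2)) g^(ab) d_b phi, by Jacobi's formula. *)
Definition div_tension (g : cotensor2 M) c d p : 'rV[R]_n :=
  \sum_a (row a (pdmx c p a (sharp_dmap g c d))
    + (2^-1 * \tr (invmx (g c p) *m pdmx c p a (g c)))
      *: row a (sharp_dmap g c d p)
    + row a (sharp_dmap g c d p) *m conn h d (row a (dmap phi c d p)) (phi p)).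

Lemma conn_sum (d : chart N) y k (X : 'rV[R]_k) (D : 'M[R]_(k, n)) :
  conn h d (X *m D) y = \sum_a X 0 a *: conn h d (row a D) y.
Proof.
rewrite /conn; under eq_bigr do rewrite mxE scaler_suml.
rewrite exchange_big; apply: eq_bigr => a _; rewrite scaler_sumr.
by apply: eq_bigr => l _; rewrite scalerA mxE.
Qed.

(** Expanding the direction [X] in coordinates gives the tension sum the shape treated by
    [frame_sum]. *)
Lemma nabla_dE g c d p X : nabla_d g h phi c d p X =
  fun Y => \sum_a X 0 a *: (Y *m (pdmx c p a (dmap phi c d)
    + dmap phi c d p *m conn h d (row a (dmap phi c d p)) (phi p)
    - christoffel g c a p *m dmap phi c d p)).
Proof.
apply/funext => Y; rewrite /nabla_d dirmxE conn_sum [conn g c X p]/conn.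
rewrite mulmx_sumr mulmx_suml -big_split -sumrB mulmx_sumr /=.
by apply: eq_bigr => a _; rewrite -scalemxAr -scalemxAl -scalerDr -scalerBr scalemxAr.
Qed.

(** The contracted Christoffel symbols supply the derivative of g^-1 that completes g^-1 d_a D to
    the derivative of g^-1 D, together with the trace term. *)
Lemma tensionE g (c : chart M) (d : chart N) p e :
  smooth_map phi -> cdom c p -> cdom d (phi p) -> regular_metric g c p ->
  Defs.orthonormal (g c p) e -> tension g h phi c d p e = div_tension g c d p.
Proof.
move=> sphi cp dp gr oe; rewrite /tension.
under eq_bigr do rewrite nabla_dE.
have [gu gs gd] := gr.
rewrite (frame_sum _ oe) /div_tension.
under eq_bigr do rewrite mulmxBr mulmxA.
rewrite sumrB -mulmx_suml contracted_christoffel // mulNmx opprK.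
rewrite mulmx_suml -big_split; apply: eq_bigr => a _ /=.
rewrite pdmxM //; last by move=> i j; exact: pdiff_dmap.
  rewrite mulmxDl mulmxDr raddfD /= !row_mul -scalemxAl !mulmxA.
  rewrite -!addrA [RHS]addrCA; congr (_ + _).
  by rewrite [RHS]addrA [RHS]addrC addrCA.
exact: pdiffmx_inv.
Qed.

End Tension.

(** * The sigma_2-tension field when C D = mu D *)

Section Tension2.
Context {R : realType} {m n : nat} {M : manifold R m} {N : manifold R n}.
Variables (g : cotensor2 M) (h : cotensor2 N) (phi : M -> N) (mu : M -> R).
Variables (c : chart M) (d : chart N) (p : M).
Hypotheses (cp : cdom c p) (sphi : smooth_map phi) (dp : cdom d (phi p)).

Definition dpd (f : M -> R) : 'rV[R]_m := \row_a pd c a f p.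

Local Notation D := (dmap phi c d).
Local Notation C := (cauchy_green g h phi c d).

Hypotheses (dC : pdiffmx c p C) (dmu : pdiff c p mu).
Hypothesis Dfull : \forall q \near p, row_full (D q).
Hypothesis CD : \forall q \near p, C q *m D q = mu q *: D q.

(** Cancelling D on the left in C D = mu D shows that (dphi)^t followed by dphi is mu times the
    identity of size n; its trace is that of C. *)
Lemma near_energy_density :
  \forall q \near p, energy_density g h phi c d q = 2^-1 * n%:R * mu q.
Proof.
apply: filterS2 Dfull CD => q /row_fullP[B BD]; rewrite /energy_density.
rewrite /cauchy_green mxtrace_mulC => /(congr1 (mulmx B)).
rewrite -scalemxAr !mulmxA BD mul1mx => ->.
by rewrite mxtraceZ mxtrace1 -mulrA [_ * mu q]mulrC.
Qed.

(** Covariant Leibniz rule for C D = mu D, evaluated at [X]; the left side is the summand of the two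
    trace terms of [tension2]. *)
Lemma nabla_cauchy_green X : nabla_d g h phi c d p X (X *m C p)
    + X *m nabla_end g c X C p *m D p
  = (X *m (dpd mu)^T) 0 0 *: (X *m D p) + mu p *: nabla_d g h phi c d p X X.
Proof.
have dD : pdiffmx c p D by move=> i j; exact: pdiff_dmap.
have E : dirmx c X C p *m D p + C p *m dirmx c X D p
    = (X *m (dpd mu)^T) 0 0 *: D p + mu p *: dirmx c X D p.
  rewrite !dirmxE mulmx_suml mulmx_sumr -big_split mxE scaler_suml scaler_sumr.
  rewrite -big_split /=; apply: eq_bigr => a _.
  rewrite -scalemxAl -scalemxAr -scalerDr -pdmxM //.
  by rewrite (near_pdmx cp _ CD) pdmxZ // !mxE scalerDr !scalerA [mu p * _]mulrC.
have CDp := nbhs_singleton CD.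
rewrite /nabla_d /nabla_end.
move: E CDp; move: (C p) (dirmx c X C p) => Cp dCp E CDp.
rewrite -!mulmxA -mulmxDr; set W := conn h d _ _; set G := conn g c X p.
rewrite [Cp *m (_ - _)]mulmxBr [Cp *m (_ + _)]mulmxDr mulmxBl mulmxDl.
(* The two terms [Cp *m G *m D p] cancel; [E] and [CDp] settle the others. *)
have -> : Cp *m dirmx c X D p + Cp *m (D p *m W) - Cp *m (G *m D p)
    + (dCp *m D p + Cp *m G *m D p - G *m Cp *m D p)
    = (X *m (dpd mu)^T) 0 0 *: D p
      + mu p *: (dirmx c X D p + D p *m W - G *m D p).
  rewrite -!mulmxA CDp [Cp *m (D p *m W)]mulmxA CDp -scalemxAl -scalemxAr.
  rewrite scalerBr scalerDr !addrA -E; congr (_ - _).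
  by rewrite addrAC subrK addrC addrA.
by rewrite mulmxDr -!scalemxAr.
Qed.

(** The energy part contributes n (mu tau + dphi(grad mu)), and summing [nabla_cauchy_green] over
    the frame removes one copy. *)
Lemma tension2E e : Defs.orthonormal (g c p) e ->
  tension2 g h phi c d p e = (n%:R - 1)
    *: (mu p *: tension g h phi c d p e + dpd mu *m sharp_dmap phi g c d p).
Proof.
move=> oe; rewrite /tension2 /div_end -addrA -opprD mulmx_suml -big_split /=.
under eq_bigr do rewrite nabla_cauchy_green.
rewrite big_split -scaler_sumr /= -/(tension g h phi c d p e).
rewrite (nbhs_singleton near_energy_density).
have -> : grad g c (energy_density g h phi c d) p *m D p
    = (2^-1 * n%:R) *: (dpd mu *m sharp_dmap phi g c d p).
  rewrite /grad -mulmxA scalemxAl; congr (_ *m _); apply/rowP => a.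
  rewrite !mxE (near_pd cp _ near_energy_density) pdM //.
  by rewrite pd_cst mul0r addr0.
(* The frame expansion of dphi(grad mu). *)
have -> : \sum_i (e i *m (dpd mu)^T) 0 0 *: (e i *m D p)
    = dpd mu *m sharp_dmap phi g c d p.
  rewrite /sharp_dmap -(orthonormal_gram oe) !mulmxA -mulmxA.
  rewrite mulmx_sum_row; apply: eq_bigr => i _.
  rewrite row_mul rowK; congr (_ *: _).
  by rewrite !mxE; apply: eq_bigr => a _; rewrite !mxE mulrC.
set t := tension _ _ _ _ _ _ _; set s := dpd mu *m _.
rewrite !scalerDr !scalerA opprD.
have -> : 2 * (2^-1 * n%:R * mu p) = n%:R * mu p by field.
have -> : 2 * (2^-1 * n%:R) = n%:R :> R by field.
rewrite scalerBl scale1r mulrBl mul1r scalerBl -!addrA; congr (_ + _).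
by rewrite addrA addrC.
Qed.

End Tension2.

(** * Change of the tension field under g' = u g^H + v g^V, for an abstract projection field P *)

Section Biconformal.
Context {R : realType} {m n : nat} {M : manifold R m} {N : manifold R n}.
Variables (g g' : cotensor2 M) (h : cotensor2 N) (phi : M -> N).
Variables (c : chart M) (d : chart N) (p : M).
Variables (P : M -> 'M[R]_m) (u v : M -> R).

Local Notation D := (dmap phi c d).

Hypotheses (cp : cdom c p) (sphi : smooth_map phi) (dp : cdom d (phi p)).
Hypothesis gr : regular_metric g c p.
Hypotheses (dP : pdiffmx c p P) (du : pdiff c p u) (dv : pdiff c p v).
Hypothesis PP : \forall q \near p, P q *m P q = P q.
Hypothesis Pg : \forall q \near p, (P q *m g c q)^T = P q *m g c q.
Hypothesis PD : \forall q \near p, P q *m D q = D q.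
Hypothesis trP : \forall q \near p, \tr (P q) = n%:R.
Hypothesis u0 : forall q, u q != 0.
Hypothesis v0 : forall q, v q != 0.

(** Acts as [s] on the image of P and as [t] on that of 1 - P, so products and inverses are taken on
    the two scalars. *)
Let B (s t : R) q : 'M[R]_m := s *: P q + t *: (1%:M - P q).

Hypothesis g'E : \forall q \near p, g' c q = B (u q) (v q) q *m g c q.

Let BM s t s' t' q : P q *m P q = P q ->
  B s t q *m B s' t' q = B (s * s') (t * t') q.
Proof.
move=> PPq; rewrite /B mulmxDl !mulmxDr -!scalemxAl -!scalemxAr.
rewrite !mulmxBl !mulmxBr !mul1mx mulmx1 PPq !subrr !scaler0 addr0 add0r subr0.
by rewrite !scalerA.
Qed.

Let BV q : P q *m P q = P q -> B (u q)^-1 (v q)^-1 q *m B (u q) (v q) q = 1%:M.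
Proof. by move=> PPq; rewrite BM // !mulVf // /B !scale1r addrCA subrr addr0. Qed.

Lemma near_invmx_biconformal : \forall q \near p,
  g' c q \in unitmx /\ invmx (g' c q) = invmx (g c q) *m B (u q)^-1 (v q)^-1 q.
Proof.
have [gu _ _] := gr; apply: filterS3 gu PP g'E => q guq PPq g'q.
have E : invmx (g c q) *m B (u q)^-1 (v q)^-1 q *m g' c q = 1%:M.
  by rewrite g'q mulmxA -[_ *m B (u q) (v q) q]mulmxA BV // mulmx1 mulVmx.
have [_ Ug'] := mulmx1_unit E; split=> //.
by rewrite -[RHS](mulmxK Ug') E mul1mx.
Qed.

Let dQ : pdiffmx c p (fun q => 1%:M - P q).
Proof.
under eq_fun do rewrite -scaleN1r.
apply: pdiffmxD; first exact: pdiffmx_cst.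
exact: (pdiffmxZ (@pdiff_cst _ _ _ c p (-1)) dP).
Qed.

Let dB : pdiffmx c p (fun q => B (u q) (v q) q).
Proof. by apply: pdiffmxD; exact: pdiffmxZ. Qed.

Lemma regular_biconformal : regular_metric g' c p.
Proof.
have [gu gs gd] := gr; split.
- by apply: filterS near_invmx_biconformal => q [].
- apply: filterS3 gs Pg g'E => q gsq Pgq ->.
  rewrite /B mulmxDl -!scalemxAl mulmxBl mul1mx linearD !linearZ /=.
  by rewrite linearB /= Pgq gsq.
- apply: (@near_pdiffmx _ _ _ _ _ cp _ _ (fun q => B (u q) (v q) q *m g c q)).
    by apply: filterS g'E => q ->.
  exact: pdiffmxM.
Qed.

(** Since (1 - P) D = 0, the matrix D sees only the horizontal factor. *)
Lemma near_sharp_biconformal : \forall q \near p,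
  sharp_dmap phi g' c d q = (u q)^-1 *: sharp_dmap phi g c d q.
Proof.
apply: filterS2 PD near_invmx_biconformal => q PDq [_ E].
rewrite /sharp_dmap E -mulmxA scalemxAr; congr (_ *m _).
by rewrite mulmxDl -!scalemxAl mulmxBl mul1mx PDq subrr scaler0 addr0.
Qed.

(** The trace of P is constant, and tracing the derivative of P P = P gives tr P' = 2 tr (P P'). *)
Let trPdP a : \tr (pdmx c p a P) = 0 /\ \tr (P p *m pdmx c p a P) = 0.
Proof.
have tr0 : \tr (pdmx c p a P) = 0.
  by rewrite -pd_mxtrace // (near_pd cp _ trP) pd_cst.
split=> //; have : \tr (pdmx c p a P) = \tr (pdmx c p a (fun q => P q *m P q)).
  by congr (\tr _); apply: near_pdmx => //; apply: filterS PP => q ->.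
rewrite pdmxM // mxtraceD mxtrace_mulC tr0 -mulr2n => /esym/eqP.
by rewrite mulrn_eq0 /= => /eqP.
Qed.

(* The logarithmic derivative of det g' / det g = u^n v^(m - n); the
   derivative of P does not contribute because P is a projection. *)
Lemma trace_biconformal a :
  \tr (invmx (g' c p) *m pdmx c p a (g' c))
  = \tr (invmx (g c p) *m pdmx c p a (g c))
    + n%:R * (u p)^-1 * pd c a u p + (m%:R - n%:R) * (v p)^-1 * pd c a v p.
Proof.
have [gu _ gd] := gr; have guq := nbhs_singleton gu.
have PPp := nbhs_singleton PP.
rewrite (near_pdmx cp _ g'E) pdmxM // (nbhs_singleton near_invmx_biconformal).2.
rewrite mulmxDr mxtraceD addrC -!addrA; congr (_ + _).
  by rewrite mulmxA -[invmx _ *m _ *m _]mulmxA BV // mulmx1.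
rewrite -mulmxA mxtrace_mulC -!mulmxA mulmxV // mulmx1.
have pdQ : pdmx c p a (fun q => 1%:M - P q) = - pdmx c p a P.
  have E : pdmx c p a (fun q => P q + (1%:M - P q)) = 0.
    rewrite -(pdmx_cst c p a (1%:M : 'M[R]_m)); apply: near_pdmx => //.
    by apply: nearW => q; rewrite addrC subrK.
  by apply/eqP; rewrite -addr_eq0 addrC -pdmxD // E.
rewrite pdmxD; [|exact: pdiffmxZ|exact: pdiffmxZ].
rewrite !pdmxZ // pdQ /B.
have [t1 t2] := trPdP a; have t3 : \tr (P p) = n%:R := nbhs_singleton trP.
move: t1 t2 t3 PPp; set dPa := pdmx c p a P; set Pp := P p => t1 t2 t3 PPp.
rewrite !(mulmxDl, mulmxDr, mulmxBl, mulmxBr, mul1mx, mulmx1, =^~ scalemxAl,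
  =^~ scalemxAr, mulmxN, mulNmx, PPp).
rewrite !(mxtraceD, mxtraceZ, raddfB, raddfN) /= !(mxtraceZ, t1, t2, t3, mxtrace1).
by rewrite ?raddfN /= ?(t1, t2, t3); ring.
Qed.

(** Half of [trace_biconformal] yields the coefficients n/2 and (m - n)/2; the -1 comes from
    differentiating the factor u^-1 of the new g'^-1 D. *)
Lemma div_tension_biconformal : div_tension h phi g' c d p = (u p)^-1 *:
  (div_tension h phi g c d p
   + (((n%:R / 2 - 1) / u p) *: dpd c p u
      + ((m%:R - n%:R) / 2 / v p) *: dpd c p v) *m sharp_dmap phi g c d p).
Proof.
have [gu _ gd] := gr.
have dD : pdiffmx c p D by move=> i j; exact: pdiff_dmap.
have dS : pdiffmx c p (sharp_dmap phi g c d).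
  by apply: pdiffmxM => //; exact: pdiffmx_inv.
rewrite [X in _ + X]mulmx_sum_row /div_tension -big_split scaler_sumr /=.
apply: eq_bigr => a _.
rewrite (near_pdmx cp _ near_sharp_biconformal) (nbhs_singleton near_sharp_biconformal).
rewrite pdmxZ //; last exact: pdiffV.
rewrite pdV // trace_biconformal.
set S := sharp_dmap phi g c d p.
have rZ k (A : 'M[R]_(m, n)) : row a (k *: A) = k *: row a A by exact: linearZ.
have rD (A A' : 'M[R]_(m, n)) : row a (A + A') = row a A + row a A'.
  exact: linearD.
rewrite rD !rZ -scalemxAl mxE [X in (X + _) *: row a S]mxE.
rewrite [X in (_ + X) *: row a S]mxE ![dpd _ _ _ _ _]mxE.
move: (row a S *m conn h d (row a (D p)) (phi p)) (row a S)
  (row a (pdmx c p a (sharp_dmap phi g c d))) => W rS rP.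
move: (\tr (invmx (g c p) *m pdmx c p a (g c))) (pd c a u p) (pd c a v p) => t du' dv'.
by apply/rowP => k; rewrite !mxE; field; rewrite u0 v0.
Qed.

End Biconformal.

(** * Horizontal conformality in matrix form, and the horizontal projection *)

Section HorizontallyConformal.
Context {R : realType} {m n : nat} {M : manifold R m} {N : manifold R n}.
Variables (g : cotensor2 M) (h : cotensor2 N) (phi : M -> N) (lam : M -> R).
Hypotheses (gR : riemannian g) (hR : riemannian h).
Hypothesis phiHC : horizontally_conformal g h phi lam.
Variables (c : chart M) (d : chart N).

Local Notation D := (dmap phi c d).

(* Equal to hproj by hprojE; unlike proj_mx it is visibly differentiable. *)
Definition hor_end p : 'M[R]_m := lam p ^- 2 *: cauchy_green g h phi c d p.

Section Pointwise.
Variable p : M.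
Hypotheses (cp : cdom c p) (dp : cdom d (phi p)).

Let sphi : smooth_map phi. Proof. by case: phiHC => -[]. Qed.

Lemma dmap_full : row_full (D p).
Proof. by case: phiHC => -[_ +] _ _ _; apply. Qed.

(** With [sub_ver], this identifies [ver] as the kernel of D in any chart [d] around [phi p]. *)
Lemma ver_dmap : ver phi c p *m D p = 0.
Proof.
have d0 := projT2 (cid (cdom_cover (phi p))).
have [J ->] := dmap_change sphi cp d0 dp.
by rewrite mulmxA mulmx_ker mul0mx.
Qed.

Lemma sub_ver k (A : 'M[R]_(k, m)) : A *m D p = 0 -> (A <= ver phi c p)%MS.
Proof.
have d0 := projT2 (cid (cdom_cover (phi p))).
have [J E] := dmap_change sphi cp dp d0.
move=> AD; apply/sub_kermxP; rewrite -[chart_at _]/(projT1 _).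
by rewrite [dmap _ _ _ _]E mulmxA AD mul0mx.
Qed.

Lemma inner_eq0 (X : 'rV[R]_m) : inner (g c p) X X = 0 -> X = 0.
Proof.
by move=> X0; apply: contra_eq X0 => /(riemannian_pos gR cp); rewrite lt0r => /andP[].
Qed.

(* The horizontal space consists of the vectors W D^T g^-1, on which
   horizontal conformality reads L h L = lam^2 L with L = D^T g^-1 D
   invertible. *)
Lemma dmap_sharp_dmap :
  h d (phi p) *m ((D p)^T *m sharp_dmap phi g c d p) = (lam p ^+ 2)%:M.
Proof.
have gu := riemannian_unit gR cp; have gs := riemannian_sym gR cp.
have hs := riemannian_sym hR dp.
pose V := invmx (g c p); have Vs : V^T = V by rewrite /V trmx_inv gs.
pose L := (D p)^T *m V *m D p.
have Ls : L^T = L by rewrite /L !trmx_mul trmxK Vs mulmxA.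
have horW (W : 'rV[R]_n) : (W *m (D p)^T *m V <= hor g phi c p)%MS.
  apply/sub_kermxP; rewrite mulmxA mulmxKV //.
  by rewrite -mulmxA -trmx_mul ver_dmap trmx0 mulmx0.
have LhL (W W' : 'rV[R]_n) :
    (W *m (L *m h d (phi p) *m L) *m W'^T) 0 0
    = (W *m (lam p ^+ 2 *: L) *m W'^T) 0 0.
  case: phiHC => _ _ _ /(_ c d p _ _ cp dp (horW W) (horW W')).
  rewrite /inner !trmx_mul !trmxK Vs !mulmxA mulmxKV // => E.
  rewrite -scalemxAr -scalemxAl [RHS]mxE /L !mulmxA E; congr (_ * _).
have {}LhL : L *m h d (phi p) *m L = lam p ^+ 2 *: L.
  apply/matrixP => i j; have := LhL (delta_mx 0 i) (delta_mx 0 j).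
  by rewrite -!rowE trmx_delta -!colE !mxE.
(* If W L = 0 then W D^T g^-1 has norm zero, so W D^T = 0, and W = 0 because dphi is surjective. *)
have Lu : L \in unitmx.
  rewrite -row_free_unit -kermx_eq0; apply/eqP/row_matrixP => i.
  rewrite row0; set W := row i _.
  have WL : W *m L = 0 by rewrite /W -row_mul mulmx_ker row0.
  have /inner_eq0 W0 : inner (g c p) (W *m (D p)^T *m V) (W *m (D p)^T *m V) = 0.
    rewrite /inner !trmx_mul !trmxK Vs !mulmxA mulmxKV //.
    by rewrite -[W *m _ *m _]mulmxA -[W *m _ *m _]mulmxA -/L WL mul0mx mxE.
  have [B BD] := row_fullP dmap_full.
  rewrite -[W]mulmx1 -trmx1 -BD trmx_mul mulmxA.
  by rewrite -[W *m _](mulmxKV gu) W0 !mul0mx.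
rewrite /sharp_dmap [(D p)^T *m _]mulmxA -/V -/L; apply: (can_inj (mulKmx Lu)).
by rewrite mulmxA LhL mul_mx_scalar.
Qed.

Let lam0 : lam p != 0.
Proof. by case: phiHC => _ _ /(_ p) /lt0r_neq0. Qed.

Lemma hor_end_dmap : hor_end p *m D p = D p.
Proof.
rewrite /hor_end /cauchy_green /dmap_adj -scalemxAl -!mulmxA.
rewrite dmap_sharp_dmap mul_mx_scalar scalerA mulVf ?scale1r //.
by rewrite expf_neq0.
Qed.

Lemma hor_end_idem : hor_end p *m hor_end p = hor_end p.
Proof.
by rewrite {2 3}/hor_end /cauchy_green -!scalemxAr mulmxA hor_end_dmap.
Qed.

Lemma hor_end_sym : (hor_end p *m g c p)^T = hor_end p *m g c p.
Proof.
rewrite /hor_end /cauchy_green /dmap_adj -!scalemxAl linearZ /=.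
have gu := riemannian_unit gR cp.
rewrite -!mulmxA mulVmx // mulmx1 !trmx_mul trmxK.
by rewrite (riemannian_sym hR dp) mulmxA.
Qed.

Lemma tr_hor_end : \tr (hor_end p) = n%:R.
Proof.
rewrite /hor_end mxtraceZ /cauchy_green mxtrace_mulC /dmap_adj -!mulmxA.
rewrite dmap_sharp_dmap mxtrace_scalar mulrnAr mulVf //.
by rewrite expf_neq0.
Qed.

Lemma hor_end_hor : (hor_end p <= hor g phi c p)%MS.
Proof.
apply/sub_kermxP; rewrite mulmxA -hor_end_sym -trmx_mul mulmxA.
by rewrite /hor_end /cauchy_green -scalemxAr mulmxA ver_dmap mul0mx scaler0 mul0mx trmx0.
Qed.

Lemma hor_end_ver : (1%:M - hor_end p <= ver phi c p)%MS.
Proof. by apply: sub_ver; rewrite mulmxBl mul1mx hor_end_dmap subrr. Qed.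

Lemma hor_ver0 : (hor g phi c p :&: ver phi c p = 0)%MS.
Proof.
apply/eqP/rowV0P => X; rewrite sub_capmx => /andP[/sub_kermxP XH /submxP[Y XV]].
apply: inner_eq0; rewrite /inner {2}XV trmx_mul mulmxA.
by rewrite -[X *m g c p *m _]mulmxA XH mul0mx mxE.
Qed.

(** Split 1 as (1 - P) + P: [proj_mx] kills the first, vertical term and fixes the second,
    horizontal one. *)
Lemma hprojE : hproj g phi c p = hor_end p.
Proof.
rewrite -[LHS]mul1mx -{1}[1%:M](subrK (hor_end p)) mulmxDl.
rewrite (proj_mx_0 hor_ver0 hor_end_ver) add0r.
exact: (proj_mx_id hor_ver0 hor_end_hor).
Qed.

Lemma vprojE : vproj g phi c p = 1%:M - hor_end p.
Proof.
have VH0 : (ver phi c p :&: hor g phi c p = 0)%MS by rewrite capmxC hor_ver0.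
rewrite -[LHS]mul1mx -{1}[1%:M](subrK (hor_end p)) mulmxDl.
by rewrite (proj_mx_0 VH0 hor_end_hor) addr0 (proj_mx_id VH0 hor_end_ver).
Qed.

Lemma metric_hor_end_tr : g c p *m (hor_end p)^T = hor_end p *m g c p.
Proof. by rewrite -hor_end_sym trmx_mul (riemannian_sym gR cp). Qed.

Lemma hpartE : hpart g phi c p = hor_end p *m g c p.
Proof. by rewrite /hpart hprojE -mulmxA metric_hor_end_tr mulmxA hor_end_idem. Qed.

Lemma vpartE : vpart g phi c p = (1%:M - hor_end p) *m g c p.
Proof.
rewrite /vpart vprojE linearB /= trmx1 -mulmxA mulmxBr mulmx1 metric_hor_end_tr.
rewrite -{1}[g c p]mul1mx -mulmxBl mulmxA; congr (_ *m _).
by rewrite mulmxBl mul1mx mulmxBr mulmx1 hor_end_idem subrr subr0.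
Qed.

(** dphi is injective on horizontal vectors: P D = D gives one direction, and P = lam^-2 D (dphi)^t
    the other. *)
Lemma gradH_eq0 f : gradH g phi c f p = 0 <-> dpd c p f *m sharp_dmap phi g c d p = 0.
Proof.
rewrite /gradH hprojE mulmxA -/(grad g c f p); split=> [E|E].
  by rewrite -hor_end_dmap mulmxA E mul0mx.
by rewrite /hor_end /cauchy_green -scalemxAr mulmxA E mul0mx scaler0.
Qed.

Lemma regular_riemannian : regular_metric g c p.
Proof.
have nc := near_cdom cp; split.
- by apply: filterS nc => q; exact: riemannian_unit.
- by apply: filterS nc => q; exact: riemannian_sym.
- by move=> i j; exact: smooth_pdiff (riemannian_smooth gR c i j) cp cp.
Qed.

Lemma pdiff_lam : pdiff c p lam.
Proof. by case: phiHC => _ sl _ _; exact: smooth_pdiff sl I cp. Qed.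

Lemma pdiffmx_pullback : pdiffmx c p (fun q => h d (phi q)).
Proof.
move=> i j; apply: (@pdiff_comp_map _ _ _ _ _ phi c d p sphi cp dp
  (fun y => h d y i j)).
exact: smooth_differentiable (riemannian_smooth hR d i j) dp dp.
Qed.

Lemma pdiffmx_cauchy_green g' : regular_metric g' c p ->
  pdiffmx c p (cauchy_green g' h phi c d).
Proof.
move=> [gu _ gd]; have dD : pdiffmx c p D by move=> i j; exact: pdiff_dmap.
apply: pdiffmxM => //; apply: pdiffmxM; last exact: pdiffmx_inv.
by apply: pdiffmxM; [exact: pdiffmx_pullback|exact: pdiffmx_tr].
Qed.

Lemma pdiffmx_hor_end : pdiffmx c p hor_end.
Proof.
apply: pdiffmxZ; last exact: pdiffmx_cauchy_green regular_riemannian.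
apply: pdiffV => //; first by rewrite expf_neq0.
exact: pdiffX pdiff_lam.
Qed.

End Pointwise.
End HorizontallyConformal.

(** * Both tension fields of a harmonic morphism for a biconformal metric *)

Section HarmonicMorphism.
Context {R : realType} {m n : nat} {M : manifold R m} {N : manifold R n}.
Variables (g : cotensor2 M) (h : cotensor2 N) (phi : M -> N) (lam : M -> R).
Hypotheses (gR : riemannian g) (hR : riemannian h).
Hypothesis phiHM : submersive_harmonic_morphism g h phi lam.
Variables (c : chart M) (d : chart N) (p : M).
Hypotheses (cp : cdom c p) (dp : cdom d (phi p)).

Let phiHC : horizontally_conformal g h phi lam. Proof. by case: phiHM. Qed.
Let sphi : smooth_map phi. Proof. by case: phiHC => -[]. Qed.

Lemma dilation_gt0 q : 0 < lam q. Proof. by case: phiHC. Qed.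

Lemma near_hpart_vpart : \forall q \near p,
  hpart g phi c q + vpart g phi c q = g c q.
Proof.
apply: filterS (near_charts sphi cp dp) => q [cq dq].
by rewrite (hpartE gR hR phiHC cq dq) (vpartE gR hR phiHC cq dq) -mulmxDl
  addrC subrK mul1mx.
Qed.

(** Harmonicity is quantified over orthonormal bases, so one has to be exhibited before it can be
    applied. *)
Lemma harmonic_div_tension : div_tension h phi g c d p = 0.
Proof.
have [e oe] := ex_orthonormal (riemannian_sym gR cp)
  (fun X => riemannian_pos gR cp (X := X)).
rewrite -(tensionE h sphi cp dp (regular_riemannian gR cp) oe).
by case: phiHM => _; apply.
Qed.

Variables (g' : cotensor2 M) (u v : M -> R).
Hypotheses (du : pdiff c p u) (dv : pdiff c p v).
Hypotheses (u0 : forall q, u q != 0) (v0 : forall q, v q != 0).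
Hypothesis g'E : \forall q \near p,
  g' c q = u q *: hpart g phi c q + v q *: vpart g phi c q.
Variable e : 'I_m -> 'rV[R]_m.
Hypothesis oe : Defs.orthonormal (g' c p) e.

(** The logarithmic differential of u^(n/2 - 1) v^((m - n)/2). *)
Local Notation w := (((n%:R / 2 - 1) / u p) *: dpd c p u
  + ((m%:R - n%:R) / 2 / v p) *: dpd c p v).
Local Notation S := (sharp_dmap phi g c d p).
Local Notation mu := (fun q => lam q ^+ 2 * (u q)^-1).
Local Notation P := (hor_end g h phi lam c d).

Let gr : regular_metric g c p. Proof. exact: regular_riemannian. Qed.

Let dP : pdiffmx c p P. Proof. exact: (pdiffmx_hor_end gR hR phiHC cp dp). Qed.

Let near_pointwise (Q : set M) : (forall q, cdom c q -> cdom d (phi q) -> Q q) ->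
  \forall q \near p, Q q.
Proof. by move=> H; apply: filterS (near_charts sphi cp dp) => q []; exact: H. Qed.

Let PP : \forall q \near p, P q *m P q = P q.
Proof. by apply: near_pointwise => q cq dq; exact: hor_end_idem. Qed.

Let Pg : \forall q \near p, (P q *m g c q)^T = P q *m g c q.
Proof. by apply: near_pointwise => q cq dq; exact: hor_end_sym. Qed.

Let PD : \forall q \near p, P q *m dmap phi c d q = dmap phi c d q.
Proof. by apply: near_pointwise => q cq dq; exact: hor_end_dmap. Qed.

Let trP : \forall q \near p, \tr (P q) = n%:R.
Proof. by apply: near_pointwise => q cq dq; exact: tr_hor_end. Qed.

Let g'P : \forall q \near p,
  g' c q = (u q *: P q + v q *: (1%:M - P q)) *m g c q.
Proof.
apply: filterS2 g'E (near_charts sphi cp dp) => q -> [cq dq].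
by rewrite (hpartE gR hR phiHC cq dq) (vpartE gR hR phiHC cq dq) [RHS]mulmxDl -!scalemxAl.
Qed.

Let gr' : regular_metric g' c p.
Proof. exact: regular_biconformal gr dP du dv PP Pg u0 v0 g'P. Qed.

Let near_sharp : \forall q \near p,
  sharp_dmap phi g' c d q = (u q)^-1 *: sharp_dmap phi g c d q.
Proof. exact: near_sharp_biconformal gr PP PD u0 v0 g'P. Qed.

Lemma tension_biconformal : tension g' h phi c d p e = (u p)^-1 *: (w *m S).
Proof.
rewrite (tensionE h sphi cp dp gr' oe).
rewrite (div_tension_biconformal h cp sphi dp gr dP du dv PP PD trP u0 v0 g'P).
by rewrite harmonic_div_tension add0r.
Qed.

(** An instance of [tension2E] for g', whose Cauchy-Green tensor satisfies C' D = (lam^2 / u) D. *)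
Lemma tension2_biconformal : tension2 g' h phi c d p e =
  ((n%:R - 1) / u p) *: ((mu p *: w + dpd c p mu) *m S).
Proof.
have dmu : pdiff c p mu.
  apply: pdiffM; last exact: pdiffV.
  exact: pdiffX (pdiff_lam phiHC cp).
rewrite (@tension2E _ _ _ _ _ g' h phi mu c d p cp sphi dp) //.
- rewrite tension_biconformal (nbhs_singleton near_sharp) -scalemxAr.
  set k := lam p ^+ 2 / u p; rewrite [k *: (_ *: _)]scalerA [k * _]mulrC.
  rewrite -[(_ * k) *: _]scalerA -scalerDr.
  by rewrite scalerA scalemxAl -mulmxDl.
- exact: (pdiffmx_cauchy_green hR phiHC cp dp gr').
- apply: near_pointwise => q cq dq.
  exact: (dmap_full phiHC cq dq).
apply: filterS2 near_sharp (near_charts sphi cp dp) => q Sq [cq dq].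
rewrite /cauchy_green /dmap_adj -!mulmxA -/(sharp_dmap phi g' c d q) Sq.
rewrite -!scalemxAr (dmap_sharp_dmap gR hR phiHC cq dq) mul_mx_scalar scalerA.
by rewrite mulrC.
Qed.

End HarmonicMorphism.

(** * Differentials of powers and quotients *)

Lemma dpd_scale (R : realType) (m : nat) (M : manifold R m) (c : chart M) p
    (f : M -> R) (F : M -> R) k :
  (forall a, pd c a F p = k * pd c a f p) -> dpd c p F = k *: dpd c p f.
Proof. by move=> E; apply/rowP => a; rewrite !mxE E. Qed.

(** The derivative is written with [f p]^ s / f p[so that]f p [^ s] is the only real power left for
    [field] to treat as an atom. *)
Lemma dpd_powR (R : realType) (m : nat) (M : manifold R m) (c : chart M) p
    (f : M -> R) s : cdom c p -> smooth_fun f -> 0 < f p ->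
  pdiff c p (fun q => f q `^ s) /\
  dpd c p (fun q => f q `^ s) = (s * f p `^ s / f p) *: dpd c p f.
Proof.
move=> cp sf f0; have df := smooth_differentiable sf I cp.
split; first exact: pdiff_powR.
apply: dpd_scale => a; rewrite pd_powR //; congr (_ * _).
rewrite powRB ?powRr1 ?ltW ?mulrA //.
by rewrite (gt_eqF f0) implybT.
Qed.

Lemma dpd_sqr (R : realType) (m : nat) (M : manifold R m) (c : chart M) p
    (f : M -> R) : cdom c p -> pdiff c p f ->
  pdiff c p (fun q => f q ^+ 2) /\
  dpd c p (fun q => f q ^+ 2) = (2 * f p) *: dpd c p f.
Proof.
move=> cp df; split; first exact: pdiffX.
by apply: dpd_scale => a; rewrite pdX // expr1.
Qed.

Lemma dpd_div (R : realType) (m : nat) (M : manifold R m) (c : chart M) p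
    (f f' : M -> R) : cdom c p -> pdiff c p f -> pdiff c p f' -> f' p != 0 ->
  dpd c p (fun q => f q / f' q)
  = (f' p)^-1 *: dpd c p f - (f p / f' p ^+ 2) *: dpd c p f'.
Proof.
move=> cp df df' f0; apply/rowP => a; rewrite !mxE.
by rewrite (pdM cp a df (pdiffV cp f0 df')) (pdV cp a f0 df'); field.
Qed.

(** * The biconformal and conformal criteria *)

Section CriticalMaps.
Context {R : realType} {m n : nat} {M : manifold R m} {N : manifold R n}.
Variables (g : cotensor2 M) (h : cotensor2 N) (phi : M -> N) (lam : M -> R).
Hypotheses (gR : riemannian g) (hR : riemannian h).
Hypothesis phiHM : submersive_harmonic_morphism g h phi lam.
Hypothesis mn : (n < m)%N.

Let slam : smooth_fun lam. Proof. by case: phiHM => -[]. Qed.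
Let lam_gt0 q : 0 < lam q. Proof. exact: dilation_gt0 phiHM q. Qed.
Let lam0 q : lam q != 0. Proof. exact: lt0r_neq0. Qed.
Let dlam c p : cdom c p -> pdiff c p lam.
Proof. by move=> cp; exact: smooth_pdiff slam I cp. Qed.

(** With u = lam^2 the factor mu is constantly 1, and the vertical exponent makes [w] vanish, so
    both tension fields are zero. *)
Lemma sigma12_critical_biconformal K :
  sigma12_critical K (fun c p => lam p ^+ 2 *: hpart g phi c p
    + lam p `^ (- ((2 * n%:R - 4) / (m%:R - n%:R))) *: vpart g phi c p) h phi.
Proof.
move=> c d p e cp dp oe; set s := - _ in oe *.
have [du Du] := dpd_sqr cp (dlam cp).
have [dv Dv] := dpd_powR s cp slam (lam_gt0 p).
have u0 q : lam q ^+ 2 != 0 by rewrite expf_neq0.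
have v0 q : lam q `^ s != 0 by rewrite gt_eqF // powR_gt0.
set g' : cotensor2 M := fun c p => _ in oe *.
have g'E : \forall q \near p, g' c q =
  lam q ^+ 2 *: hpart g phi c q + lam q `^ s *: vpart g phi c q by exact: nearW.
have mn0 : m%:R - n%:R != 0 :> R by rewrite subr_eq0 eqr_nat gt_eqF.
(* In terms of d log lam the coefficient is (n - 2) + s (m - n)/2, which determines [s]. *)
have w0 : ((n%:R / 2 - 1) / lam p ^+ 2) *: dpd c p (fun q => lam q ^+ 2)
    + ((m%:R - n%:R) / 2 / lam p `^ s) *: dpd c p (fun q => lam q `^ s) = 0.
  rewrite Du Dv !scalerA -scalerDl [X in X *: _](_ : _ = 0) ?scale0r // /s.
  by field; rewrite v0 lam0 mn0.
have mu0 : dpd c p (fun q => lam q ^+ 2 / lam q ^+ 2) = 0.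
  under eq_fun do rewrite divff //.
  by apply/rowP => a; rewrite !mxE pd_cst.
rewrite (tension2_biconformal gR hR phiHM cp dp du dv u0 v0 g'E oe).
rewrite (tension_biconformal gR hR phiHM cp dp du dv u0 v0 g'E oe).
by rewrite w0 mu0 scaler0 addr0 !mul0mx !scaler0 addr0.
Qed.

Section Conformal.
Variables (c : chart M) (d : chart N) (p : M) (u : M -> R).
Hypotheses (cp : cdom c p) (dp : cdom d (phi p)).
Hypotheses (du : pdiff c p u) (u0 : forall q, u q != 0).
Variable e : 'I_m -> 'rV[R]_m.
Hypothesis oe : Defs.orthonormal (u p *: g c p) e.

Let g'E : \forall q \near p, scale u g c q =
  u q *: hpart g phi c q + u q *: vpart g phi c q.
Proof.
apply: filterS (near_hpart_vpart gR hR phiHM cp dp) => q E.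
by rewrite -scalerDr E.
Qed.

(** For u = v the dimension n cancels out of [w]. *)
Let wE : ((n%:R / 2 - 1) / u p) *: dpd c p u
    + ((m%:R - n%:R) / 2 / u p) *: dpd c p u
  = ((m%:R / 2 - 1) / u p) *: dpd c p u.
Proof. by rewrite -scalerDl; congr (_ *: _); field. Qed.

Lemma tension_conformal : tension (scale u g) h phi c d p e =
  (u p)^-1 *: (((m%:R / 2 - 1) / u p) *: dpd c p u *m sharp_dmap phi g c d p).
Proof.
by rewrite (tension_biconformal gR hR phiHM cp dp du du u0 u0 g'E oe) wE.
Qed.

Lemma tension2_conformal : tension2 (scale u g) h phi c d p e =
  ((n%:R - 1) / u p) *:
    ((lam p ^+ 2 / u p) *: (((m%:R / 2 - 1) / u p) *: dpd c p u)
     + dpd c p (fun q => lam q ^+ 2 / u q)) *m sharp_dmap phi g c d p.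
Proof.
rewrite (tension2_biconformal gR hR phiHM cp dp du du u0 u0 g'E oe) wE.
by rewrite scalemxAl.
Qed.

End Conformal.

(** For u = lam^s, mu w + d mu equals mu (s (m/2 - 2) + 2) d log lam, which vanishes for s = 4 / (4
    - m). *)
Lemma sigma2_critical_conformal : m <> 4%N ->
  sigma2_critical (scale (fun p => lam p `^ (4 / (4 - m%:R))) g) h phi.
Proof.
move=> m4 c d p e cp dp oe.
set s := 4 / _ in oe *.
have [du Du] := dpd_powR s cp slam (lam_gt0 p).
have u0 q : lam q `^ s != 0 by rewrite gt_eqF // powR_gt0.
have m0 : 4 - m%:R != 0 :> R.
  by rewrite subr_eq0 eqr_nat; apply/eqP => /esym.
have [dl Dl] := dpd_sqr cp (dlam cp).
rewrite (tension2_conformal cp dp du u0 oe) (dpd_div cp dl du) // Du Dl.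
rewrite !scalerA -scalerBl -scalerDl !scalerA.
rewrite [X in X *: _](_ : _ = 0) ?scale0r ?mul0mx // /s.
by field; rewrite u0 lam0 m0.
Qed.

(** By [key], tau + K tau_sigma2 for b^2 g is b^-m dphi(grad f), where f is the bracket of the
    criterion; [gradH_eq0] translates its vanishing. *)
Lemma sigma12_critical_conformal K b :
  smooth_fun b -> (forall p, 0 < b p) ->
  (sigma12_critical K (scale (fun p => b p ^+ 2) g) h phi <->
   forall c p, cdom c p ->
     gradH g phi c (fun q => b q ^ (m%:Z - 4)
       * (b q ^+ 2 + K * (n%:R - 1) * lam q ^+ 2)) p = 0).
Proof.
move=> sb b_gt0; have b0 q : b q != 0 by exact: lt0r_neq0.
pose f q := b q ^ (m%:Z - 4) * (b q ^+ 2 + K * (n%:R - 1) * lam q ^+ 2).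
have key c d p e : cdom c p -> cdom d (phi p) ->
    Defs.orthonormal (b p ^+ 2 *: g c p) e ->
    tension (scale (fun p => b p ^+ 2) g) h phi c d p e
      + K *: tension2 (scale (fun p => b p ^+ 2) g) h phi c d p e
    = (b p ^+ m)^-1 *: (dpd c p f *m sharp_dmap phi g c d p).
  move=> cp dp oe; have db := smooth_pdiff sb I cp.
  have [du Du] := dpd_sqr cp db.
  have [dl Dl] := dpd_sqr cp (dlam cp).
  have u0 q : b q ^+ 2 != 0 by rewrite expf_neq0.
  rewrite (tension_conformal cp dp du u0 oe) (tension2_conformal cp dp du u0 oe).
  rewrite !scalemxAl -mulmxDl; congr (_ *m _).
  rewrite (dpd_div cp dl du (u0 p)) Du Dl; apply/rowP => a; rewrite !mxE.
  pose f1 q := b q ^+ 2; pose f2 q := lam q ^+ 2; pose f3 q := b q ^+ m.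
  pose f4 q := b q ^+ 4; pose k : M -> R := fun=> K * (n%:R - 1).
  have b40 : f4 p != 0 by rewrite expf_neq0.
  have dk : pdiff c p k by exact: pdiff_cst.
  have d1 : pdiff c p f1 by exact: du.
  have d2 : pdiff c p f2 by exact: dl.
  have d3 : pdiff c p f3 by exact: pdiffX.
  have d4 : pdiff c p f4 by exact: pdiffX.
  have d4V : pdiff c p (fun q => (f4 q)^-1) by exact: pdiffV.
  have d34 : pdiff c p (fun q => f3 q * (f4 q)^-1) := pdiffM d3 d4V.
  have dk2 : pdiff c p (fun q => k q * f2 q) := pdiffM dk d2.
  (* The integer exponent m - 4 may be negative; b^m / b^4 needs only the rules for natural powers
     and inverses. *)
  have -> : f = fun q => f3 q * (f4 q)^-1 * (f1 q + k q * f2 q).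
    by apply/funext => q; rewrite /f expfzDr.
  rewrite (pdM cp a d34 (pdiffD d1 dk2)) (pdM cp a d3 d4V) (pdV cp a b40 d4).
  rewrite (pdD a d1 dk2) (pdM cp a dk d2) pd_cst.
  rewrite (pdX cp a 2 db) (pdX cp a 2 (dlam cp)) (pdX cp a m db) (pdX cp a 4 db).
  rewrite /f1 /f2 /f3 /f4 /k.
  (* The derivative of b^m brings in b^(m-1); both are expressed through [m.-1], which is legitimate
     as n < m forces m > 0. *)
  have -> : b p ^+ m = b p * b p ^+ m.-1 by rewrite -exprS prednK // (leq_trans _ mn).
  have -> : m%:R = m.-1%:R + 1 :> R by rewrite natr1 prednK // (leq_trans _ mn).
  move: (pd c a b p) (pd c a lam p) => db' dl'.
  have bm0 : b p ^+ m.-1 != 0 by rewrite expf_neq0.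
  by rewrite /= !expr1; field; rewrite b0 bm0.
have pos p : b p ^+ 2 > 0 by rewrite exprn_gt0.
split=> [crit c p cp | crit c d p e cp dp oe].
  have dp := projT2 (cid (cdom_cover (phi p))).
  rewrite (gradH_eq0 gR hR (proj1 phiHM) cp dp).
  (* An orthonormal basis for b^2 g, at which criticality can be evaluated. *)
  have [||e oe] := @ex_orthonormal R m (b p ^+ 2 *: g c p).
  - by rewrite linearZ /= (riemannian_sym gR cp).
  - move=> X X0; rewrite /inner -scalemxAr -scalemxAl mxE mulr_gt0 //.
    exact: (riemannian_pos gR cp X0).
  have := crit c _ p e cp dp oe; rewrite key // => /eqP.
  by rewrite scaler_eq0 invr_eq0 expf_eq0 (negPf (b0 p)) andbF => /eqP.
rewrite key //; have /(gradH_eq0 gR hR (proj1 phiHM) cp dp) -> := crit c p cp.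
by rewrite scaler0.
Qed.

End CriticalMaps.

Theorem proposition2p1 (R : realType) (m n : nat)
    (M : manifold R m) (N : manifold R n)
    (g : cotensor2 M) (h : cotensor2 N) (phi : M -> N) (lam : M -> R) (K : R)
    (mn : (n < m)%N) (gR : riemannian g) (hR : riemannian h)
    (phiHM : submersive_harmonic_morphism g h phi lam) (K0 : 0 < K) :
  [/\
    let g1 : cotensor2 M := fun c p =>
      lam p ^+ 2 *: hpart g phi c p
      + lam p `^ (- ((2 * n%:R - 4) / (m%:R - n%:R))) *: vpart g phi c p in
    g1 = biconformal g phi (fun p => (lam p)^-1) /\ sigma12_critical K g1 h phi,
    forall b : M -> R, smooth_fun b -> (forall p, 0 < b p) ->
      (sigma12_critical K (scale (fun p => b p ^+ 2) g) h phi <->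
       forall c p, cdom c p ->
         gradH g phi c (fun q => b q ^ (m%:Z - 4)
           * (b q ^+ 2 + K * (n%:R - 1) * lam q ^+ 2)) p = 0)
  & m <> 4%N ->
      sigma2_critical (scale (fun p => lam p `^ (4 / (4 - m%:R))) g) h phi ].
Proof.
split; last exact: (sigma2_critical_conformal gR hR phiHM).
  split; last exact: (sigma12_critical_biconformal gR hR phiHM mn).
  apply/funext => c; apply/funext => p; rewrite /biconformal.
  have l0 : 0 < lam p by exact: dilation_gt0 phiHM p.
  congr (_ *: _ + _ *: _); first by rewrite exprVn invrK.
  (* Reading 1/lam as lam to the power -1 turns the vertical exponent into its opposite. *)
  by rewrite -(powR_inv1 (ltW l0)) -powRrM mulN1r.
exact: (sigma12_critical_conformal gR hR phiHM mn).
Qed.
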